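(* Let $N\geq 3$ and let $G\subset S_N^+$ be a closed quantum subgroup, with magic unitary $u=(u_{ij})$ and Haar integration $\int_G$. Then $G$ is $3$-transitive, in the sense that $\dim(\mathrm{Fix}(u^{\otimes 3}))=5$, if and only if for any distinct $i,k,p\in\{1,\ldots,N\}$ and any distinct $j,l,q\in\{1,\ldots,N\}$ one has $$\int_G u_{ij}u_{kl}u_{pq}=\frac{1}{N(N-1)(N-2)}.$$ In addition, in the classical case, where $G\subset S_N$ is a usual permutation group with $u_{ij}=\chi(\sigma\in G\mid\sigma(j)=i)$, this notion of $3$-transitivity coincides with the usual one, i.e. with the transitivity of the action of $G$ on the set of triples of distinct elements of $\{1,\ldots,N\}$.
   Context: A magic unitary is a square matrix $u\in M_N(A)$ over a unital $C^*$-algebra $A$ whose entries are projections ($p=p^*=p^2$) summing up to $1$ on each row and each column. The quantum permutation group $S_N^+$ is the compact quantum group (in the sense of Woronowicz) whose algebra $C(S_N^+)$ is the universal $C^*$-algebra generated by the entries of an $N\times N$ magic unitary $u=(u_{ij})$, with comultiplication $\Delta(u_{ij})=\sum_k u_{ik}\otimes u_{kj}$, counit $\varepsilon(u_{ij})=\delta_{ij}$ and antipode $S(u_{ij})=u_{ji}$. A closed subgroup $G\subset S_N^+$ is a compact quantum group given by a quotient $C(S_N^+)\to C(G)$ compatible with these structural maps; its magic unitary, still denoted $u=(u_{ij})$, is the image of the universal one. $\int_G:C(G)\to\mathbb C$ denotes the Haar functional. The corepresentation $u^{\otimes k}$ acts on $(\mathbb C^N)^{\otimes k}$ and has coefficients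 $(u^{\otimes k})_{i_1\ldots i_k,j_1\ldots j_k}=u_{i_1j_1}\cdots u_{i_kj_k}$, and $\mathrm{Fix}(u^{\otimes k})\subset(\mathbb C^N)^{\otimes k}$ is its space of fixed vectors. *)

(* Defs.v *)
(* Complex numbers are R[i], for R : realType. *)
From HB Require Import structures.
From mathcomp Require Import all_boot all_order all_algebra all_fingroup all_solvable.
From mathcomp Require Import complex.
From mathcomp Require Import boolp reals.

Set Implicit Arguments.
Unset Strict Implicit.
Unset Printing Implicit Defensive.

Import Order.TTheory GRing.Theory Num.Theory.
Local Open Scope ring_scope.
Local Open Scope complex_scope.

(* The norm is carried by the mixin because Hierarchy-Builder has no join of
   the ring structures with the normed modules below numDomainType. *)
HB.mixin Record isCStarAlgebra (R : realType) A of GRing.Algebra R[i] A := {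
  cnorm : A -> R;
  star : A -> A;
  cnorm_eq0 : forall x : A, cnorm x = 0 -> x = 0;
  cnormD : forall x y : A, cnorm (x + y) <= cnorm x + cnorm y;
  cnormZ : forall (c : R[i]) (x : A), (cnorm (c *: x))%:C = `|c| * (cnorm x)%:C;
  cnormM : forall x y : A, cnorm (x * y) <= cnorm x * cnorm y;
  cnorm_complete : forall a : nat -> A,
    (forall e : R, 0 < e -> exists n0 : nat, forall m n : nat,
        (n0 <= m)%N -> (n0 <= n)%N -> cnorm (a m - a n) < e) ->
    exists l : A, forall e : R, 0 < e -> exists n0 : nat, forall n : nat,
        (n0 <= n)%N -> cnorm (a n - l) < e;
  starK : forall x : A, star (star x) = x;
  starD : forall x y : A, star (x + y) = star x + star y;
  starZ : forall (c : R[i]) (x : A), star (c *: x) = c^* *: star x;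
  starM : forall x y : A, star (x * y) = star y * star x;
  cnorm_star : forall x : A, cnorm (star x * x) = cnorm x ^+ 2
}.

#[short(type="cstarAlgType")]
HB.structure Definition CStarAlgebra (R : realType) :=
  {A of GRing.Algebra R[i] A & isCStarAlgebra R A}.

Definition star_preserving (R : realType) (A B : cstarAlgType R) (f : A -> B) :=
  forall x : A, f (star x) = star (f x).

Definition bounded_map (R : realType) (A B : cstarAlgType R) (f : A -> B) :=
  exists M : R, forall x : A, cnorm (f x) <= M * cnorm x.

Definition is_state (R : realType) (A : cstarAlgType R) (f : {scalar A}) :=
  (forall x : A, 0 <= f (star x * x)) /\ f 1 = 1.

(* Every element is a norm limit of finite sums of f a b. *)
Definition dense_sums (R : realType) (A B T : cstarAlgType R) (f : A -> B -> T) :=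
  forall (x : T) (e : R), 0 < e ->
    exists s : seq (A * B), cnorm (x - \sum_(p <- s) f p.1 p.2) < e.

Section FormalTensors.
Variables (R : realType) (A B : cstarAlgType R).
Implicit Types s t : seq (A * B).

(* s stands for the element \sum_(p <- s) p.1 (x) p.2 of the algebraic tensor
   product of A and B. *)
Definition tens_star s : seq (A * B) := [seq (star p.1, star p.2) | p <- s].
Definition tens_mul s t : seq (A * B) :=
  [seq (p.1 * q.1, p.2 * q.2) | p <- s, q <- t].
Definition tens_eval (f : {scalar A}) (g : {scalar B}) s : R[i] :=
  \sum_(p <- s) f p.1 * g p.2.

(* The GNS representations of two states f, g satisfy
     |(pi_f (x) pi_g)(s)| = sup_t sqrt ((f (x) g)(t* s* s t) / (f (x) g)(t* t)),
   so the clause below says that the spatial norm of s is at most r. *)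
Definition spatial_norm_le s (r : R) :=
  forall (f : {scalar A}) (g : {scalar B}), is_state f -> is_state g ->
  forall t, tens_eval f g
              (tens_mul (tens_star t) (tens_mul (tens_mul (tens_star s) s) t))
            <= (r ^+ 2)%:C * tens_eval f g (tens_mul (tens_star t) t).
End FormalTensors.

(* (T, tens) is the minimal (spatial) C*-tensor product of A and B. *)
Record is_min_tensor (R : realType) (A B T : cstarAlgType R)
    (tens : A -> B -> T) : Prop := {
  tens_linearl : forall b : B, linear (tens^~ b);
  tens_linearr : forall a : A, linear (tens a);
  tens1 : tens 1 1 = 1;
  tensM : forall (a a' : A) (b b' : B),
    tens (a * a') (b * b') = tens a b * tens a' b';
  tens_starE : forall (a : A) (b : B), tens (star a) (star b) = star (tens a b);
  tens_dense : dense_sums tens;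
  tens_norm : forall (s : seq (A * B)) (r : R), 0 <= r ->
    (cnorm (\sum_(p <- s) tens p.1 p.2) <= r <-> spatial_norm_le s r)
}.

(* (Delta (x) id) Delta = (id (x) Delta) Delta on A, where T = A (x) A.
   The triple product is A3 = T (x) A, and leg23 (b (x) c) = 1 (x) b (x) c. *)
Definition coassociative (R : realType) (A T : cstarAlgType R)
    (tens : A -> A -> T) (Delta : A -> T) :=
  exists (A3 : cstarAlgType R) (tens3 : T -> A -> A3)
         (Delta_id id_Delta leg23 : {lrmorphism T -> A3}),
    [/\ is_min_tensor tens3,
        [/\ star_preserving Delta_id, star_preserving id_Delta
          & star_preserving leg23],
        (forall a b : A, Delta_id (tens a b) = tens3 (Delta a) b)
        /\ (forall b c : A, leg23 (tens b c) = tens3 (tens 1 b) c),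
        forall a b : A,
          id_Delta (tens a b) = tens3 (tens a 1) 1 * leg23 (Delta b)
      & forall a : A, Delta_id (Delta a) = id_Delta (Delta a)].

Record compact_quantum_group (R : realType) := CompactQuantumGroup {
  cqg_alg :> cstarAlgType R;
  cqg_alg2 : cstarAlgType R;
  tens : cqg_alg -> cqg_alg -> cqg_alg2;
  tensP : is_min_tensor tens;
  Delta : {lrmorphism cqg_alg -> cqg_alg2};
  Delta_star : star_preserving Delta;
  Delta_coassoc : coassociative tens Delta;
  Delta_cancell : dense_sums (fun a b : cqg_alg => Delta a * tens 1 b);
  Delta_cancelr : dense_sums (fun a b : cqg_alg => Delta a * tens b 1)
}.

Definition is_haar (R : realType) (G : compact_quantum_group R)
    (h : {scalar G}) :=
  is_state h /\
  (* hl = h (x) id and hr = id (x) h on C(G) (x) C(G) *)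
  exists hl hr : {linear cqg_alg2 G -> G},
    [/\ bounded_map hl /\ bounded_map hr,
        (forall a b : G, hl (tens a b) = h a *: b),
        (forall a b : G, hr (tens a b) = h b *: a)
      & forall a : G, hl (Delta G a) = h a *: 1 /\ hr (Delta G a) = h a *: 1].

Definition is_projection (R : realType) (A : cstarAlgType R) (x : A) :=
  star x = x /\ x * x = x.

Definition is_magic (R : realType) (A : cstarAlgType R) (N : nat) (u : 'M[A]_N) :=
  [/\ forall i j : 'I_N, is_projection (u i j),
      forall i : 'I_N, \sum_(j < N) u i j = 1
    & forall j : 'I_N, \sum_(i < N) u i j = 1].

(* No proper norm-closed unital *-subalgebra contains all the entries of u. *)
Definition generated_by (R : realType) (A : cstarAlgType R) (N : nat)
    (u : 'M[A]_N) :=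
  forall P : A -> Prop,
    (forall i j : 'I_N, P (u i j)) ->
    P 1 ->
    (forall (c : R[i]) (x y : A), P x -> P y -> P (c *: x + y)) ->
    (forall x y : A, P x -> P y -> P (x * y)) ->
    (forall x : A, P x -> P (star x)) ->
    (forall x : A,
       (forall e : R, 0 < e -> exists2 y : A, P y & cnorm (x - y) < e) -> P x) ->
  forall x : A, P x.

Definition is_universal_magic (R : realType) (A : cstarAlgType R) (N : nat)
    (u : 'M[A]_N) :=
  [/\ is_magic u, generated_by u
    & forall (B : cstarAlgType R) (w : 'M[B]_N), is_magic w ->
      exists2 f : {lrmorphism A -> B}, star_preserving f
        & forall i j : 'I_N, f (u i j) = w i j].

Definition is_character (R : realType) (A : cstarAlgType R)
    (f : {lrmorphism A -> R[i]^o}) :=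
  forall x : A, f (star x) = (f x)^*.

(* Unital *-morphisms A -> A^op *)
Definition is_antimorphism (R : realType) (A : cstarAlgType R)
    (f : {linear A -> A}) :=
  [/\ f 1 = 1, forall x y : A, f (x * y) = f y * f x & star_preserving f].

(* S_N^+ is determined only up to isomorphism: an element of this type is one
   of its models. *)
Record quantum_permutation_group (R : realType) (N : nat) := QuantumPermGroup {
  SN_cqg :> compact_quantum_group R;
  SN_magic : 'M[SN_cqg]_N;
  SN_universal : is_universal_magic SN_magic;
  SN_Delta : forall i j : 'I_N,
    Delta SN_cqg (SN_magic i j)
    = \sum_(k < N) tens (SN_magic i k) (SN_magic k j);
  SN_counit : {lrmorphism SN_cqg -> R[i]^o};
  SN_counitP : is_character SN_counit;
  SN_counitE : forall i j : 'I_N, SN_counit (SN_magic i j) = (i == j)%:R;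
  SN_antipode : {linear SN_cqg -> SN_cqg};
  SN_antipodeP : is_antimorphism SN_antipode;
  SN_antipodeE : forall i j : 'I_N, SN_antipode (SN_magic i j) = SN_magic j i
}.

Record closed_subgroup (R : realType) (N : nat)
    (SN : quantum_permutation_group R N) := ClosedSubgroup {
  sub_cqg :> compact_quantum_group R;
  sub_proj : {lrmorphism SN -> sub_cqg};
  sub_proj_star : star_preserving sub_proj;
  sub_proj_surj : forall y : sub_cqg, exists x : SN, sub_proj x = y;
  sub_proj2 : {lrmorphism cqg_alg2 SN -> cqg_alg2 sub_cqg};
  sub_proj2_star : star_preserving sub_proj2;
  sub_proj2E : forall a b : SN,
    sub_proj2 (tens a b) = tens (sub_proj a) (sub_proj b);
  sub_Delta : forall a : SN,
    Delta sub_cqg (sub_proj a) = sub_proj2 (Delta SN a);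
  sub_counit : {lrmorphism sub_cqg -> R[i]^o};
  sub_counitP : is_character sub_counit;
  sub_counitE : forall a : SN, sub_counit (sub_proj a) = SN_counit SN a;
  sub_antipode : {linear sub_cqg -> sub_cqg};
  sub_antipodeP : is_antimorphism sub_antipode;
  sub_antipodeE : forall a : SN,
    sub_antipode (sub_proj a) = sub_proj (SN_antipode SN a)
}.

Definition magic_unitary (R : realType) (N : nat)
    (SN : quantum_permutation_group R N) (G : closed_subgroup SN) : 'M[G]_N :=
  map_mx (sub_proj G) (SN_magic SN).

Section FixedVectors.
Variables (R : realType) (A : algType R[i]) (N k : nat) (u : 'M[A]_N).

(* (C^N)^{(x) k}, a vector being given by its coordinates on the basis
   e_{i_1} (x) ... (x) e_{i_k} *)
Definition tensor_space := {ffun k.-tuple 'I_N -> R[i]^o}.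

Definition tensor_coef (i j : k.-tuple 'I_N) : A :=
  \prod_(a < k) u (tnth i a) (tnth j a).

Definition is_fixed (xi : tensor_space) :=
  forall i : k.-tuple 'I_N,
    \sum_(j : k.-tuple 'I_N) (xi j : R[i]) *: tensor_coef i j
    = (xi i : R[i]) *: (1 : A).

Lemma is_fixed_lin (c : R[i]) (x y : tensor_space) :
  is_fixed x -> is_fixed y -> is_fixed (c *: x + y).
Proof.
move=> fx fy i; rewrite !ffunE scalerDl -scalerA -fx -fy scaler_sumr -big_split.
by apply: eq_bigr => j _; rewrite !ffunE scalerDl scalerA.
Qed.

Lemma Fix_subproof :
  exists V : {vspace tensor_space}, forall xi, xi \in V <-> is_fixed xi.
Proof.
pose Q n := exists2 V : {vspace tensor_space},
  \dim V = n & forall xi, xi \in V -> is_fixed xi.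
have fix0 : is_fixed 0.
  by move=> i; rewrite ffunE scale0r big1 // => j _; rewrite ffunE scale0r.
have Q0 : exists n, `[< Q n >].
  exists 0%N; apply/asboolP; exists 0%VS; first exact: dimv0.
  by move=> xi; rewrite memv0 => /eqP ->.
have Qle n : `[< Q n >] -> (n <= \dim {: tensor_space})%N.
  by move=> /asboolP[V <- _]; apply: dimvS; apply: subvf.
case: (ex_maxnP Q0 Qle) => n /asboolP[V dV VF] nmax.
exists V => xi; split=> [/VF //|fxi].
have QW : Q (\dim (V + <[xi]>)%VS).
  exists (V + <[xi]>)%VS => // z /memv_addP[v /VF fv [w /vlineP[c ->] ->]].
  by rewrite addrC; apply: is_fixed_lin.
have : (V + <[xi]>)%VS == V.
  by rewrite eq_sym eqEdim addvSl dV; apply/nmax/asboolP.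
by move/eqP <-; apply: (subvP (addvSr _ _)); exact: memv_line.
Qed.

Definition Fix : {vspace tensor_space} := projT1 (cid Fix_subproof).

Lemma FixP xi : xi \in Fix <-> is_fixed xi.
Proof. exact: (projT2 (cid Fix_subproof)). Qed.

End FixedVectors.

Definition three_transitive (R : realType) (N : nat)
    (SN : quantum_permutation_group R N) (G : closed_subgroup SN) :=
  \dim (Fix 3 (magic_unitary G)) = 5%N.

(* G is the permutation group H: C(G) is identified with the *-algebra of
   functions on H so that u_ij is the indicator of {s in H | s(j) = i}. *)
Definition is_classical (R : realType) (N : nat)
    (SN : quantum_permutation_group R N) (G : closed_subgroup SN)
    (H : {group 'S_N}) :=
  exists f : G -> {ffun [subg H] -> R[i]},
    [/\ bijective f,
        [/\ linear f, f 1 = 1 & forall x y : G, f (x * y) = f x * f y],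
        forall (x : G) (s : [subg H]), f (star x) s = (f x s)^*
      & forall (i j : 'I_N) (s : [subg H]),
          f (magic_unitary G i j) s = (sgval s j == i)%:R].

(* Main.v *)
(* By the C*-identity, projections summing to 1 are pairwise orthogonal, so a
   product u_ij u_il or u_ij u_kj of entries of a magic unitary vanishes off the
   diagonal. It follows that every vector of (C^N)^{(x) 3} whose coordinates
   depend only on the coincidence pattern of the indices is fixed. Such vectors
   form a space of dimension 5, so 3-transitivity means that there are no other
   fixed vectors.

   Put P_ij = int_G u_{i1 j1} u_{i2 j2} u_{i3 j3}. By invariance the columns of
   P are fixed, and every fixed vector xi satisfies xi = P xi. If all the fixed
   vectors are functions of the pattern then P_ij is constant over the distinct
   triples i, and the sum rules give its value. Conversely the sum rules and the
   value of P on distinct triples determine all of P: P_ij vanishes unless i and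
   j have the same pattern, and then depends only on that pattern, so xi = P xi
   is a function of the pattern.

   For G a permutation group the fixed vectors are the functions on triples that
   are invariant under G. *)
Require Import Defs.
From mathcomp Require Import all_boot all_order all_algebra all_fingroup all_solvable.
From mathcomp Require Import complex ring lra zify.
From mathcomp Require Import reals.

Import Order.TTheory GRing.Theory Num.Theory.
Local Open Scope ring_scope.
Local Open Scope complex_scope.

(** * Orthogonality in C*-algebras *)

Section CStarNorm.
Variables (R : realType) (A : cstarAlgType R).
Implicit Types (x y p q : A) (r : R) (c : R[i]).

Lemma cnormZ_norm c r x : `|c| = r%:C -> cnorm (c *: x) = r * cnorm x.
Proof. by move=> cr; apply: complexI; rewrite cnormZ cr rmorphM. Qed.

Lemma cnormZ_real r x : 0 <= r -> cnorm (r%:C *: x) = r * cnorm x.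
Proof.
by move=> r0; apply: cnormZ_norm; rewrite ger0_norm // ler0c.
Qed.

Lemma cnorm0 : cnorm (0 : A) = 0.
Proof. by rewrite -(scale0r 0) (@cnormZ_real 0) ?mul0r. Qed.

Lemma cnormN x : cnorm (- x) = cnorm x.
Proof.
by rewrite -scaleN1r (@cnormZ_norm _ 1) ?mul1r // normrN1.
Qed.

Lemma cnormB x y : cnorm (x - y) <= cnorm x + cnorm y.
Proof. by rewrite (le_trans (cnormD _ _)) // cnormN. Qed.

Lemma cnorm_ge0 x : 0 <= cnorm x.
Proof.
have := cnormB x x; rewrite subrr cnorm0; lra.
Qed.

Lemma cnorm_sum (I : finType) (F : I -> A) :
  cnorm (\sum_i F i) <= \sum_i cnorm (F i).
Proof.
elim/big_rec2: _ => [|i y z _ le_zy]; first by rewrite cnorm0.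
by rewrite (le_trans (cnormD _ _)) // lerD2l.
Qed.

Lemma cnormM_le1 x y : cnorm x <= 1 -> cnorm y <= 1 -> cnorm (x * y) <= 1.
Proof.
move=> x1 y1; apply: le_trans (cnormM _ _) _.
by rewrite mulr_ile1 ?cnorm_ge0.
Qed.

Lemma cnorm_projection p : is_projection p -> cnorm p <= 1.
Proof.
case=> sp pp; have := cnorm_star p; rewrite sp pp.
by have := cnorm_ge0 p; nra.
Qed.

Lemma starN x : star (- x) = - star x.
Proof. by rewrite -scaleN1r starZ rmorphN1 scaleN1r. Qed.

Lemma starB x y : star (x - y) = star x - star y.
Proof. by rewrite starD starN. Qed.

Lemma star1 : star (1 : A) = 1.
Proof. by rewrite -[LHS]mulr1 -{2}[1]starK -starM mulr1 starK. Qed.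

Lemma projectionC p : is_projection p -> is_projection (1 - p).
Proof.
case=> sp pp; split; first by rewrite starB star1 sp.
by rewrite mulrBl mul1r mulrBr mulr1 pp subrr subr0.
Qed.

Lemma half_sum x : (2^-1)%:C *: (x + x) = x.
Proof.
by rewrite -mulr2n -scaler_nat scalerA fmorphV rmorph_nat mulVf ?scale1r ?pnatr_eq0.
Qed.

Lemma cnorm_half_sum x y : cnorm x <= 1 -> cnorm y <= 1 ->
  cnorm ((2^-1)%:C *: (x + y)) <= 1.
Proof.
move=> x1 y1; rewrite cnormZ_real ?invr_ge0 ?ler0n //.
have := cnormD x y; lra.
Qed.

(** * Extremality of a projection in the unit ball of its corner *)

Lemma corner_mul p x (a b : R[i]) : p * p = p -> p * x = x -> x * p = x ->
  (p + a *: x) * (p + b *: x) = p + (a + b) *: x + (a * b) *: x ^+ 2.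
Proof.
move=> pp px xp.
rewrite mulrDl !mulrDr pp -!scalerAr px -!scalerAl xp scalerA -expr2.
by rewrite scalerDl [a *: x + b *: x]addrC [b * a]mulrC !addrA.
Qed.

Lemma corner_cube p x c : p * p = p -> p * x = x -> x * p = x ->
  (p + c *: x) ^+ 3
  = p + (3 * c) *: x + (3 * c ^+ 2) *: x ^+ 2 + c ^+ 3 *: x ^+ 3.
Proof.
move=> pp px xp; have px2 : p * x ^+ 2 = x ^+ 2 by rewrite expr2 mulrA px.
rewrite exprS expr2 corner_mul // -mulr2n -[c *+ 2]mulr_natl.
have e1 : 3 * c = 2 * c + c by ring.
have e2 : 3 * c ^+ 2 = c * c + c * (2 * c) by ring.
rewrite mulrDl !mulrDr pp -!scalerAr px px2 -!scalerAl xp !scalerA -expr2 -!exprS.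
rewrite e1 e2 !scalerDl !addrA [c * (2 * c)]mulrC -expr2 -exprSr.
by do 2 congr (_ + _); exact: addrAC.
Qed.

(* If all the p + i^k x lie in the unit ball, so do all the p + (3/2) i^k x, by
   writing p + (3/2) x as a convex combination of cubes of elements p + c x
   with c in the convex hull of the powers of i. *)
Lemma corner_amplify p x : p * p = p -> p * x = x -> x * p = x ->
  cnorm (p + x) <= 1 -> cnorm (p + 'i%R *: x) <= 1 -> cnorm (p - 'i%R *: x) <= 1 ->
  cnorm (p + (3 / 2) *: x) <= 1.
Proof.
move=> pp px xp n1 n2 n3.
have cube y : cnorm y <= 1 -> cnorm (y ^+ 3) <= 1.
  by move=> y1; rewrite !exprS expr0 mulr1; do !apply: cnormM_le1.
have sc (r : R) y : 0 <= r -> cnorm y <= 1 -> cnorm (r%:C *: y) <= r.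
  by move=> r0 y1; rewrite cnormZ_real // ler_piMr.
have i2 : ('i%R : R[i]) ^+ 2 = -1 by rewrite sqrCi.
pose y c := p + c *: x.
pose L (a b c d : R[i]) := a *: p + b *: x + c *: x ^+ 2 + d *: x ^+ 3.
have LD a b c d a' b' c' d' :
    L a b c d + L a' b' c' d' = L (a + a') (b + b') (c + c') (d + d').
  rewrite /L addrACA -scalerDl; congr (_ + _).
  by rewrite addrACA -scalerDl; congr (_ + _); rewrite addrACA -!scalerDl.
have LZ k a b c d : k *: L a b c d = L (k * a) (k * b) (k * c) (k * d).
  by rewrite /L !scalerDr !scalerA.
have y3 c : y c ^+ 3 = L 1 (3 * c) (3 * c ^+ 2) (c ^+ 3).
  by rewrite /y corner_cube // /L scale1r.
(* The weights 1/6, 1/12, 1/12, 1/3, 1/3 sum to 1. Under them the five values of [c] have mean 1/2,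
   while [c^2] and [c^3] have mean 0; so the averaged cubes have linear coefficient 3/2 and no
   higher terms. *)
have -> : p + (3 / 2) *: x =
    (6^-1)%:C *: y 1 ^+ 3 + ((12^-1)%:C *: y 'i%R ^+ 3 + (12^-1)%:C *: y (-'i%R) ^+ 3)
    + ((3^-1)%:C *: y ((1 + 'i%R) / 2) ^+ 3 + (3^-1)%:C *: y ((1 - 'i%R) / 2) ^+ 3).
  rewrite !y3 !LZ !LD !fmorphV /= !rmorph_nat.
  have -> : p + (3 / 2) *: x = L 1 (3 / 2) 0 0.
    by rewrite /L scale1r !scale0r !addr0.
  congr (L _ _ _ _).
  - by field.
  - by field.
  - by transitivity (1 + ('i%R : R[i]) ^+ 2); [rewrite i2 subrr | by field].
  - by transitivity ((1 + ('i%R : R[i]) ^+ 2) / 4); [rewrite i2 subrr mul0r | by field].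
have y1 : cnorm (y 1) <= 1 by rewrite /y scale1r.
have yi : cnorm (y 'i%R) <= 1 by [].
have yi' : cnorm (y (- 'i%R)) <= 1 by rewrite /y scaleNr.
have yh a b : cnorm (y a) <= 1 -> cnorm (y b) <= 1 -> cnorm (y ((a + b) / 2)) <= 1.
  move=> ya yb; suff -> : y ((a + b) / 2) = (2^-1)%:C *: (y a + y b).
    exact: cnorm_half_sum.
  rewrite /y addrACA -mulr2n -scalerDl scalerDr -[p *+ 2]scaler_nat !scalerA.
  by rewrite fmorphV rmorph_nat mulVf ?pnatr_eq0 // scale1r mulrC.
have b1 := sc 6^-1 _ (ltac:(lra)) (cube _ y1).
have b2 := sc 12^-1 _ (ltac:(lra)) (cube _ yi).
have b3 := sc 12^-1 _ (ltac:(lra)) (cube _ yi').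
have b4 := sc 3^-1 _ (ltac:(lra)) (cube _ (yh _ _ y1 yi)).
have b5 := sc 3^-1 _ (ltac:(lra)) (cube _ (yh _ _ y1 yi')).
apply: le_trans (cnormD _ _) _; apply: le_trans (lerD (cnormD _ _) (cnormD _ _)) _.
apply: le_trans (lerD (lerD b1 (cnormD _ _)) (lerD b4 b5)) _.
apply: le_trans (lerD (lerD (lexx _) (lerD b2 b3)) (lexx _)) _.
lra.
Qed.

(* The hypotheses also put p + i x and p - i x in the unit ball, by the
   C*-identity, and corner_amplify then applies to x repeatedly. *)
Lemma corner_extreme p x : is_projection p -> star x = x ->
    p * x = x -> x * p = x ->
  cnorm (p + x) <= 1 -> cnorm (p - x) <= 1 -> x = 0.
Proof.
move=> [sp pp] sx px xp n1 n2.
have npx2 : cnorm (p + x ^+ 2) <= 1.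
  have -> : p + x ^+ 2 = (2^-1)%:C *: ((p + x) * (p + x) + (p - x) * (p - x)).
    have := corner_mul p x 1 1 pp px xp.
    rewrite mul1r scale1r => ->; rewrite -scaleN1r corner_mul // mulrNN mul1r.
    rewrite -opprD scaleNr scale1r (addrAC p) (addrAC p (- _)) addrACA subrr addr0.
    by rewrite half_sum.
  by apply: cnorm_half_sum; apply: cnormM_le1.
(* For [s] = i or -i and [x] self-adjoint, [star (p + s *: x) * (p + s *: x)] equals [p + x ^+ 2],
   whose norm was just bounded. *)
have nix (s : R[i]) : s = 'i%R \/ s = - 'i%R -> cnorm (p + s *: x) <= 1.
  move=> si; rewrite -(expr_le1 (ltn0Sn 1)) ?cnorm_ge0 //.
  rewrite -cnorm_star starD sp starZ sx corner_mul // [s^* + s](_ : _ = 0).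
    rewrite scale0r addr0 [s^* * s](_ : _ = 1) ?scale1r //.
    case: si => ->; rewrite ?rmorphN /= conjCi ?opprK ?mulNr ?mulrN -expr2;
      by rewrite sqrCi opprK.
  by case: si => ->; rewrite ?rmorphN /= conjCi ?opprK ?addNr ?subrr.
(* Applied to i^k y, [corner_amplify] consumes the bounds for the exponents k, k+1 and k+3; hence
   the bound is carried along for all powers of i at once. *)
pose D y := forall k, cnorm (p + 'i%R ^+ k *: y) <= 1.
have Dx : D x.
  elim/ltn_ind; case=> [|[|[|[|k]]]] IHk.
  - by rewrite scale1r.
  - by apply: nix; left.
  - by rewrite sqrCi scaleN1r.
  - by apply: nix; right; rewrite exprS sqrCi mulrN1.
  - have -> : ('i%R : R[i]) ^+ k.+4 = 'i%R ^+ k 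
      by rewrite -addn4 exprD (exprM _ 2 2) sqrCi sqrrN expr1n mulr1.
    by apply: IHk; rewrite ltnS -addn3 leq_addr.
have Dstep y : p * y = y -> y * p = y -> D y -> D ((3 / 2) *: y).
  move=> py yp Dy k; rewrite scalerA mulrC -scalerA.
  apply: corner_amplify => //.
  - by rewrite -scalerAr py.
  - by rewrite -scalerAl yp.
  - by rewrite scalerA -exprS.
  - rewrite -scaleNr scalerA; suff -> : - 'i%R * 'i%R ^+ k = 'i%R ^+ k.+3 :> R[i] by [].
    by rewrite -add3n exprD exprS sqrCi mulrN1.
have Dn n : D ((3 / 2) ^+ n *: x).
  elim: n => [|n IHn]; first by rewrite scale1r.
  rewrite exprS -scalerA; apply: Dstep => //.
    by rewrite -scalerAr px.
  by rewrite -scalerAl xp.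
have le1 n : (3 / 2) ^+ n * cnorm x <= 1.
  rewrite -(@cnormZ_norm ((3 / 2) ^+ n)); last first.
    rewrite ger0_norm ?exprn_ge0 ?divr_ge0 ?ler0n //.
    by rewrite rmorphXn rmorphM fmorphV !rmorph_nat.
  set y := _ *: x; have -> : y = (2^-1)%:C *: ((p + y) + - (p - y)).
    by rewrite opprB addrC addrA subrK half_sum.
  apply: cnorm_half_sum; first by have := Dn n 0; rewrite scale1r.
  by rewrite cnormN; have := Dn n 2; rewrite sqrCi scaleN1r.
(* Bernoulli's inequality makes the powers of 3/2 unbounded, whereas [le1] would bound them by the
   inverse of [cnorm x] if [x] were nonzero. *)
have bern n : 1 + n%:R / 2 <= (3 / 2) ^+ n :> R.
  elim: n => [|n IHn]; first by rewrite mul0r addr0.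
  rewrite exprS -natr1; have := ler0n R n; lra.
apply: cnorm_eq0; apply/eqP; rewrite eq_le cnorm_ge0 andbT leNgt; apply/negP => x0.
have /archi_boundP : 0 <= 2 / cnorm x by rewrite divr_ge0 ?ler0n ?cnorm_ge0.
set n := Num.bound _; rewrite ltr_pdivrMr // => lt2.
have := le1 n; have := bern n; have : 0 <= n%:R * cnorm x by lra.
nra.
Qed.

End CStarNorm.

(** A norm argument replaces positivity. In the corner of [p j], the compressions
    [b l = p j * p l * p j] with [l != j] sum to 0, and every [p j - b l] lies in the unit ball.
    Averaging n such elements puts both [p j + b i / n] and [p j - b i / n] in the unit ball, so
    [b i = 0] by extremality. As [b i] is [star (p i * p j) * (p i * p j)], the C*-identity
    concludes. *)
Lemma projections_orthogonal (R : realType) (A : cstarAlgType R) n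
    (p : 'I_n -> A) : (forall l, is_projection (p l)) -> \sum_l p l = 1 ->
  forall i j, i != j -> p i * p j = 0.
Proof.
move=> pP p1 i j; rewrite eq_sym => ji.
(* The names are crossed: [si] and [pi] are about [p j], while [sj] and [pj] are about [p i]. *)
have [si pi] := pP j; have [sj pj] := pP i.
pose b l := p j * p l * p j.
have pb l : p j * b l = b l by rewrite /b !mulrA pi.
have bp l : b l * p j = b l by rewrite /b -!mulrA pi.
have sb l : star (b l) = b l.
  by rewrite /b !starM si (proj1 (pP l)) mulrA.
have nb l : cnorm (p j - b l) <= 1.
  have -> : p j - b l = p j * (1 - p l) * p j.
    by rewrite mulrBr mulr1 mulrBl pi.
  have := cnorm_projection _ _ _ (projectionC _ _ _ (pP l)).
  have := cnorm_projection _ _ _ (pP j).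
  by move=> ? ?; do !apply: cnormM_le1.
have sumb : \sum_(l | l != j) b l = 0.
  have : \sum_l b l = p j by rewrite -mulr_suml -mulr_sumr p1 mulr1.
  rewrite (bigD1 j) //= {1}/b pi pi => /(canRL (addKr _)).
  by rewrite addNr.
have n0 : (0 < n)%N by case: (n) i {ji pj sj} => [[]|].
have nz : n%:R != 0 :> R[i] by rewrite pnatr_eq0 -lt0n.
have bound y : cnorm (n%:R *: y) <= n%:R -> cnorm y <= 1.
  rewrite (@cnormZ_norm _ _ _ n%:R) ?normr_nat ?rmorph_nat //.
  by rewrite ger_pMr // ltr0n.
have x0 : (n%:R^-1 : R[i]) *: b i = 0.
  apply: (corner_extreme _ _ (p j)) => //.
  - by rewrite starZ sb fmorphV rmorph_nat.
  - by rewrite -scalerAr pb.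
  - by rewrite -scalerAl bp.
  - apply: bound; rewrite scalerDr scalerA divff // scale1r.
    (* By [sumb], [b i] is minus the sum of the other [b l] with [l != j]; this leaves n terms, each
       of norm at most 1. *)
    have -> : n%:R *: p j + b i
      = \sum_l (p j - (if (l != j) && (l != i) then b l else 0)).
      rewrite sumrB sumr_const card_ord scaler_nat -big_mkcond /=.
      congr (_ + _); move: sumb; rewrite (bigD1 i) 1?eq_sym //=.
      by move/(canRL (addrK _)); rewrite sub0r.
    apply: le_trans (cnorm_sum _ _ _ _) _.
    have -> : n%:R = \sum_(l < n) (1 : R) by rewrite sumr_const card_ord.
    apply: ler_sum => l _; case: ifP => // _; rewrite subr0.
    exact: cnorm_projection.
  - apply: bound; rewrite scalerBr scalerA divff // scale1r.
    have -> : n%:R *: p j - b i = n.-1%:R *: p j + (p j - b i).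
      rewrite addrA -[X in _ *: _ + X - _]scale1r -scalerDl natr1 prednK //.
    apply: le_trans (cnormD _ _) _.
    rewrite -[X in _ <= X%:R](prednK n0) -natr1 lerD //.
    rewrite (@cnormZ_norm _ _ _ n.-1%:R) ?normr_nat ?rmorph_nat //.
    by rewrite ler_piMr ?ler0n //; apply: cnorm_projection.
have b0 : b i = 0.
  by apply/eqP; move/eqP: x0; rewrite scaler_eq0 invr_eq0 (negPf nz).
apply: cnorm_eq0; apply/eqP; rewrite -sqrf_eq0 -cnorm_star starM si sj.
by rewrite -mulrA (mulrA (p i)) pj mulrA -/(b i) b0 cnorm0.
Qed.

(** * Functions of the coincidence pattern *)

(** The tuple [s] picks one representative per value of [K]. The indicators of the corresponding
    classes form a basis of the functions constant on the classes, an n-dimensional subspace of [V];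
    so [V] has dimension n exactly when it is equal to this subspace. *)
Lemma dim_class_functions (F : fieldType) (I : finType) (T : eqType) (K : I -> T)
    n (s : n.-tuple I) (V : {vspace {ffun I -> F^o}}) :
    uniq (map K s) -> (forall i, K i \in map K s) ->
    (forall xi : {ffun I -> F^o},
       (forall i j, K i = K j -> xi i = xi j) -> xi \in V) ->
  (\dim V = n <->
   forall xi, xi \in V -> forall i j, K i = K j -> xi i = xi j).
Proof.
move=> Ks sK Vs.
pose e i : {ffun I -> F^o} := [ffun j => (K i == K j)%:R].
pose X := map_tuple e s.
have XE (a : 'I_n) : X`_a = e (tnth s a) by rewrite -tnth_nth tnth_map.
have eE a b : e (tnth s a) (tnth s b) = (a == b)%:R.
  by rewrite ffunE -!(tnth_map K) (inj_eq (tuple_uniqP (map_tuple K s) Ks)).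
have eK i i' a : K i = K i' -> e a i = e a i' by move=> ii'; rewrite !ffunE ii'.
have freeX : free X.
  apply/freeP => k k0 b.
  have := congr1 (fun f : {ffun I -> F^o} => f (tnth s b)) k0.
  rewrite sum_ffunE ffunE (bigD1 b) //= big1 ?addr0 => [|a ab].
    by rewrite ffunE XE eE eqxx => /eqP; rewrite scaler_eq0 oner_eq0 orbF => /eqP.
  by rewrite ffunE XE eE (negPf ab) scaler0.
have XK xi : xi \in <<X>>%VS -> forall i j, K i = K j -> xi i = xi j.
  move=> /coord_span -> i j ij; rewrite !sum_ffunE; apply: eq_bigr => a _.
  by rewrite XE !ffunE ij.
have KX (xi : {ffun I -> F^o}) :
    (forall i j, K i = K j -> xi i = xi j) -> xi \in <<X>>%VS.
  move=> xiK; suff -> : xi = \sum_(a < n) (xi (tnth s a) : F) *: X`_a.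
    apply: memv_suml => a _; apply: memvZ; apply: memv_span.
    by rewrite mem_nth ?size_tuple.
  apply/ffunP => i; have /tnthP[b] : K i \in map_tuple K s by exact: sK.
  rewrite tnth_map => Kb; rewrite (xiK _ _ Kb) sum_ffunE (bigD1 b) //=.
  rewrite big1 ?addr0 => [|a ab].
    by rewrite ffunE XE (eK _ _ _ Kb) eE eqxx /GRing.scale /= mulr1.
  by rewrite ffunE XE (eK _ _ _ Kb) eE (negPf ab) scaler0.
have dX : \dim <<X>> = n by rewrite (eqP freeX) size_tuple.
have XV : (<<X>> <= V)%VS by apply/subvP => xi /XK; apply: Vs.
split=> [dV xi|VK].
  suff -> : V = <<X>>%VS by apply: XK.
  by apply/esym/eqP; rewrite eqEdim XV dX dV /=.
rewrite -dX; congr (\dim _); apply/eqP; rewrite eqEsubv XV andbT.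
by apply/subvP => xi /VK; apply: KX.
Qed.

Lemma tuple3E (I : Type) (t : 3.-tuple I) :
  t = [tuple [tnth t 0]; [tnth t 1]; [tnth t 2]].
Proof. by apply: val_inj; case: t => [[|a [|b [|c [|? ?]]]] st]. Qed.

Lemma sum_tuple3 (V : nmodType) (I : finType) (F : 3.-tuple I -> V) :
  \sum_j F j = \sum_a \sum_b \sum_c F [tuple a; b; c].
Proof.
rewrite (reindex (fun p : I * (I * I) => [tuple p.1; p.2.1; p.2.2])) /=.
  rewrite -(pair_bigA _ (fun a q => F [tuple a; q.1; q.2])) /=.
  by apply: eq_bigr => a _; rewrite -(pair_bigA _ (fun b c => F [tuple a; b; c])).
exists (fun t : 3.-tuple I => ([tnth t 0], ([tnth t 1], [tnth t 2]))) => [[a [b c]] //|t _].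
by rewrite [RHS]tuple3E.
Qed.

(** The coincidence pattern of a triple, that is, the partition of its three positions into sets of
    equal entries, encoded by the three pairwise tests. *)
Definition ker3 (I : eqType) (i : 3.-tuple I) :=
  ([tnth i 0] == [tnth i 1], [tnth i 1] == [tnth i 2], [tnth i 0] == [tnth i 2]).

Lemma ker3E (I : eqType) (a b c : I) :
  ker3 _ [tuple a; b; c] = (a == b, b == c, a == c).
Proof. by []. Qed.

(** Transitivity of equality forbids exactly two true tests. The remaining patterns are the five
    partitions of a three-element set, whence the dimension 5. *)
Lemma ker3_mem (I : eqType) (i : 3.-tuple I) :
  ker3 _ i \in [:: (true, true, true); (true, false, false); (false, true, false);
                  (false, false, true); (false, false, false)].
Proof.
rewrite /ker3; move: [tnth i 0] [tnth i 1] [tnth i 2] => a b c.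
case: (eqVneq a b) => [<-|ab]; first by case: (a == c).
by case: (eqVneq b c) => [<-|_]; [rewrite (negPf ab) | case: (a == c)].
Qed.

(** * Fixed vectors attached to partitions of three points *)

Section OrthogonalMagic.
Variables (R : realType) (A : algType R[i]) (N : nat) (u : 'M[A]_N).

(** The purely algebraic content of a magic unitary: the study of class functions and of third
    moments rests on these relations, with no norm or involution. *)
Definition orthogonal_magic :=
  [/\ forall i j l, u i j * u i l = if j == l then u i j else 0,
      forall i k j, u i j * u k j = if i == k then u i j else 0,
      forall i, \sum_j u i j = 1
    & forall j, \sum_i u i j = 1].

Lemma tensor_coef3 (a b c d e f : 'I_N) :
  tensor_coef u [tuple a; b; c] [tuple d; e; f] = u a d * u b e * u c f.
Proof. by rewrite /tensor_coef !big_ord_recl big_ord0 mulr1 mulrA. Qed.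

Lemma is_fixed3 (xi : tensor_space R N 3) :
  is_fixed u xi <-> forall a b c,
    \sum_d \sum_e \sum_f
      (xi [tuple d; e; f] : R[i]) *: (u a d * u b e * u c f)
    = (xi [tuple a; b; c] : R[i]) *: 1.
Proof.
split=> xiF.
  move=> a b c; rewrite -xiF sum_tuple3; do 3!apply: eq_bigr => ? _.
  by rewrite tensor_coef3.
move=> i; rewrite (tuple3E _ i) -xiF sum_tuple3; do 3!apply: eq_bigr => ? _.
by rewrite tensor_coef3.
Qed.

Lemma sum_deltaZ (V : lmodType R[i]) (I : finType) (i : I) (F : I -> V) :
  \sum_j (i == j)%:R *: F j = F i.
Proof.
rewrite (bigD1 i) //= eqxx scale1r big1 ?addr0 // => j.
by rewrite eq_sym => /negPf ->; rewrite scale0r.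
Qed.

Hypothesis uP : orthogonal_magic.

Lemma sum_mul_row (x : A) i : \sum_j x * u i j = x.
Proof. by case: uP => _ _ s _; rewrite -mulr_sumr s mulr1. Qed.

Lemma sum_pair_row i k : \sum_j u i j * u k j = (i == k)%:R.
Proof.
case: uP => _ uc s _; under eq_bigr do rewrite uc.
by case: eqP => [->|_]; [exact: s | rewrite big1].
Qed.

(** The constant 1 and the indicators of [j0 = j1], [j1 = j2], [j0 = j2] and [j0 = j1 = j2] are the
    vectors of the five partitions. Each is fixed by the row sums and orthogonality, and together
    they span the class functions. The distinct points [x], [y], [z] serve to sample the value of
    [xi] on each pattern. *)
Lemma class_function_fixed (xi : tensor_space R N 3) (x y z : 'I_N) :
  x != y -> y != z -> x != z ->
  (forall i j, ker3 _ i = ker3 _ j -> xi i = xi j) -> is_fixed u xi.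
Proof.
move=> xy yz xz xiK.
pose g (P : 3.-tuple 'I_N -> bool) : tensor_space R N 3 := [ffun j => (P j)%:R].
have [ur uc sr sc] := uP.
have f0 : is_fixed u (g xpredT).
  apply/is_fixed3 => a b c; rewrite !ffunE scaler_nat -(sr a).
  apply: eq_bigr => d _; rewrite -[RHS](sum_mul_row _ b).
  apply: eq_bigr => e _; rewrite -[RHS](sum_mul_row _ c).
  by apply: eq_bigr => f _; rewrite ffunE scale1r.
have f12 : is_fixed u (g (fun i => [tnth i 0] == [tnth i 1])).
  apply/is_fixed3 => a b c; rewrite !ffunE scaler_nat.
  transitivity (\sum_d u a d * u b d); last exact: sum_pair_row.
  apply: eq_bigr => d _; rewrite -(sum_deltaZ _ _ d (fun e => u a d * u b e)).
  apply: eq_bigr => e _; rewrite -[in RHS](sum_mul_row (u a d * u b e) c).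
  by rewrite scaler_sumr; apply: eq_bigr => f _; rewrite ffunE.
have f23 : is_fixed u (g (fun i => [tnth i 1] == [tnth i 2])).
  apply/is_fixed3 => a b c; rewrite !ffunE scaler_nat.
  transitivity ((\sum_d u a d) * \sum_e u b e * u c e); last first.
    by rewrite sr mul1r; exact: sum_pair_row.
  rewrite mulr_suml.
  apply: eq_bigr => d _; rewrite mulr_sumr; apply: eq_bigr => e _; rewrite mulrA.
  rewrite -(sum_deltaZ _ _ e (fun f => u a d * u b e * u c f)).
  by apply: eq_bigr => f _; rewrite ffunE.
have f13 : is_fixed u (g (fun i => [tnth i 0] == [tnth i 2])).
  apply/is_fixed3 => a b c; rewrite !ffunE scaler_nat.
  transitivity (\sum_d u a d * u c d); last exact: sum_pair_row.
  apply: eq_bigr => d _; rewrite -[in RHS](sum_mul_row (u a d) b) mulr_suml.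
  apply: eq_bigr => e _.
  rewrite -(sum_deltaZ _ _ d (fun f => u a d * u b e * u c f)).
  by apply: eq_bigr => f _; rewrite ffunE.
have f123 :
    is_fixed u (g (fun i => ([tnth i 0] == [tnth i 1]) && ([tnth i 1] == [tnth i 2]))).
  apply/is_fixed3 => a b c; rewrite !ffunE scaler_nat.
  transitivity (\sum_d u a d * u b d * u c d); last first.
    under eq_bigr do rewrite uc; rewrite /=; case: (a =P b) => [<-|_] /=.
      exact: sum_pair_row.
    by rewrite big1 // => d _; rewrite mul0r.
  apply: eq_bigr => d _.
  rewrite -(sum_deltaZ _ _ d (fun e => u a d * u b e * u c e)).
  apply: eq_bigr => e _.
  rewrite -(sum_deltaZ _ _ e (fun f => u a d * u b e * u c f)) scaler_sumr.
  by apply: eq_bigr => f _; rewrite ffunE scalerA -natrM mulnb.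
pose v (a b c : 'I_N) : R[i] := xi [tuple a; b; c].
(* Moebius inversion on the lattice of partitions gives the coefficients from the values at xxx,
   xxy, xyy, xyx and xyz. *)
have vE (a b c : 'I_N) : v a b c =
    (v x x x - v x x y - v x y y - v x y x + 2 * v x y z) * ((a == b) && (b == c))%:R
    + ((v x x y - v x y z) * (a == b)%:R + ((v x y y - v x y z) * (b == c)%:R
    + ((v x y x - v x y z) * (a == c)%:R + (v x y z * 1 + 0)))).
  have vK d e f : (a == b, b == c, a == c) = (d == e, e == f, d == f) ->
      v a b c = v d e f by move=> K; apply: xiK.
  have E := (eqxx x, negPf xy, negPf yz, negPf xz, eqxx y).
  have yx : (y == x) = false by rewrite eq_sym (negPf xy).
  have := ker3_mem _ [tuple a; b; c]; rewrite ker3E !inE.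
  case/orP=> [/eqP K|/orP[/eqP K|/orP[/eqP K|/orP[/eqP K|/eqP K]]]].
  - by rewrite (vK x x x) ?K ?E //; case: K => -> -> -> /=; ring.
  - by rewrite (vK x x y) ?K ?E //; case: K => -> -> -> /=; ring.
  - by rewrite (vK x y y) ?K ?E //; case: K => -> -> -> /=; ring.
  - by rewrite (vK x y x) ?K ?E ?yx //; case: K => -> -> -> /=; ring.
  - by rewrite (vK x y z) ?K ?E //; case: K => -> -> -> /=; ring.
(* The nesting and the final 0 match the shape [c *: x + y] of [is_fixed_lin]. *)
have -> : xi =
    (v x x x - v x x y - v x y y - v x y x + 2 * v x y z)
      *: g (fun i => ([tnth i 0] == [tnth i 1]) && ([tnth i 1] == [tnth i 2]))
    + ((v x x y - v x y z) *: g (fun i => [tnth i 0] == [tnth i 1])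
    + ((v x y y - v x y z) *: g (fun i => [tnth i 1] == [tnth i 2])
    + ((v x y x - v x y z) *: g (fun i => [tnth i 0] == [tnth i 2])
    + (v x y z *: g xpredT + 0)))).
  by apply/ffunP => i; rewrite (tuple3E _ i) !ffunE; exact: vE.
have fix0 : is_fixed u (0 : tensor_space R N 3).
  apply/is_fixed3 => a b c; rewrite ffunE scale0r.
  by do 3!rewrite big1 // => ? _; rewrite ffunE scale0r.
by do !apply: is_fixed_lin.
Qed.

(** Since [N] is at least 3, all five patterns are realized, so the class functions form a
    5-dimensional subspace of [Fix 3 u]. *)
Lemma dim_Fix3 : (3 <= N)%N ->
  (\dim (Fix 3 u) = 5%N <-> forall xi : tensor_space R N 3, is_fixed u xi ->
     forall i j, ker3 _ i = ker3 _ j -> xi i = xi j).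
Proof.
move=> N3.
have [x [y [z [xy yz xz]]]] : exists x y z : 'I_N, [/\ x != y, y != z & x != z].
  exists (Ordinal (ltnW (ltnW N3))), (Ordinal (ltnW N3)), (Ordinal N3).
  by split.
pose s := [tuple [tuple x; x; x]; [tuple x; x; y]; [tuple x; y; y];
                 [tuple x; y; x]; [tuple x; y; z]].
have sE : map (ker3 _) s =
  [:: (true, true, true); (true, false, false); (false, true, false);
                  (false, false, true); (false, false, false)].
  by rewrite /= !ker3E !eqxx [y == x]eq_sym (negPf xy) (negPf yz) (negPf xz).
have dimP := @dim_class_functions _ _ _ (ker3 _) _ s (Fix 3 u).
rewrite dimP ?sE //; last first.
- by move=> xi xiK; apply/FixP/(class_function_fixed xi x y z).
- exact: ker3_mem.
by split=> H xi /FixP; apply: H.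
Qed.

End OrthogonalMagic.

(** * Third moments *)

Lemma sum_const_but1 (F : pzRingType) (I : finType) (f : I -> F) a k :
  (forall x, x != a -> f x = k) -> \sum_x f x = f a + (#|I|%:R - 1) * k.
Proof.
move=> fk; have -> : \sum_x f x = \sum_x (k + (if x == a then f a - k else 0)).
  by apply: eq_bigr => x _; case: eqP => [->|/eqP /fk ->];
    rewrite ?addr0 // addrC subrK.
rewrite big_split /= sumr_const -big_mkcond big_pred1_eq mulrBl mul1r mulr_natl.
by rewrite addrCA addrA.
Qed.

Lemma sum_const_but2 (F : pzRingType) (I : finType) (f : I -> F) a b k :
  a != b -> (forall x, x != a -> x != b -> f x = k) ->
  \sum_x f x = f a + f b + (#|I|%:R - 2) * k.
Proof.
move=> ab fk; pose g x := if x == b then k else f x.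
have -> : \sum_x f x = \sum_x (g x + (if x == b then f b - k else 0)).
  by apply: eq_bigr => x _; rewrite /g; case: eqP => [->|_];
    rewrite ?addr0 // addrC subrK.
rewrite big_split /= -big_mkcond big_pred1_eq.
rewrite (@sum_const_but1 _ _ g a k) /g ?(negPf ab) => [|x xa]; last first.
  by case: eqVneq => // xb; apply: fk.
have -> : #|I|%:R - 2 = #|I|%:R - 1 - 1 :> F by rewrite -addrA -opprD.
by rewrite [in RHS]mulrBl mul1r addrACA.
Qed.

Section ThirdMoments.
Variables (R : realType) (A : algType R[i]) (N : nat) (u : 'M[A]_N).
Hypotheses (N_ge3 : (3 <= N)%N) (uP : orthogonal_magic _ _ _ u).
Variable h : {scalar A}.
Hypothesis h1 : h 1 = 1.

Definition moment3 (a b c d e f : 'I_N) := h (u a d * u b e * u c f).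
Definition moment2 (a b d e : 'I_N) := h (u a d * u b e).
Local Notation P := moment3.
Local Notation Q := moment2.

(** * Sum rules from the rows and columns, vanishing rules from orthogonality *)

Lemma sum_moment3_row3 a b c d e : \sum_f P a b c d e f = Q a b d e.
Proof. by case: uP => _ _ s _; rewrite -raddf_sum -mulr_sumr s mulr1. Qed.

Lemma sum_moment3_col3 a b d e f : \sum_c P a b c d e f = Q a b d e.
Proof. by case: uP => _ _ _ s; rewrite -raddf_sum -mulr_sumr s mulr1. Qed.

Lemma sum_moment3_col2 a c d e f : \sum_b P a b c d e f = Q a c d f.
Proof. by case: uP => _ _ _ s; rewrite -raddf_sum -mulr_suml -mulr_sumr s mulr1. Qed.

Lemma sum_moment2_col2 a d e : \sum_b Q a b d e = h (u a d).
Proof. by case: uP => _ _ _ s; rewrite -raddf_sum -mulr_sumr s mulr1. Qed.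

Lemma sum_moment1_col d : \sum_a h (u a d) = 1.
Proof. by case: uP => _ _ _ s; rewrite -raddf_sum s. Qed.

Lemma moment2_row a d e : Q a a d e = if d == e then h (u a d) else 0.
Proof. by case: uP => r _ _ _; rewrite /Q r; case: eqP; rewrite ?raddf0. Qed.

Lemma moment2_col a b d : Q a b d d = if a == b then h (u a d) else 0.
Proof. by case: uP => _ r _ _; rewrite /Q r; case: eqP; rewrite ?raddf0. Qed.

Lemma moment3_row12 a c d e f : P a a c d e f = if d == e then Q a c d f else 0.
Proof. by case: uP => r _ _ _; rewrite /P r; case: eqP; rewrite ?mul0r ?raddf0. Qed.

Lemma moment3_row23 a b d e f : P a b b d e f = if e == f then Q a b d e else 0.
Proof.
by case: uP => r _ _ _; rewrite /P -mulrA r; case: eqP; rewrite ?mulr0 ?raddf0.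
Qed.

Lemma moment3_col12 a b c d f : P a b c d d f = if a == b then Q a c d f else 0.
Proof. by case: uP => _ r _ _; rewrite /P r; case: eqP; rewrite ?mul0r ?raddf0. Qed.

Lemma moment3_col23 a b c d e : P a b c d e e = if b == c then Q a b d e else 0.
Proof.
by case: uP => _ r _ _; rewrite /P -mulrA r; case: eqP; rewrite ?mulr0 ?raddf0.
Qed.


Let natC_neq0 (m : nat) : (m < N)%N -> N%:R - m%:R != 0 :> R[i].
Proof. by move=> mN; rewrite -natrB ?pnatr_eq0 ?subn_eq0 -?ltnNge // ltnW. Qed.

Let N0 : N%:R != 0 :> R[i].
Proof. by rewrite -[X in X != _]subr0; apply: (natC_neq0 0); lia. Qed.
Let N1 : N%:R - 1 != 0 :> R[i].
Proof. by apply: (natC_neq0 1); lia. Qed.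
Let N2 : N%:R - 2 != 0 :> R[i].
Proof. by apply: (natC_neq0 2); lia. Qed.

(** For distinct [d], [e], [f], the total mass 1 is expanded over one row index at a time. The terms
    with repeated rows vanish and the others are equal, which produces the factors N, N-1 and N-2 in
    turn. *)
Lemma class_moments_uniform :
    (forall a b c a' b' c' d e f, ker3 _ [tuple a; b; c] = ker3 _ [tuple a'; b'; c'] ->
       P a b c d e f = P a' b' c' d e f) ->
  forall a b c d e f, uniq [:: a; b; c] -> uniq [:: d; e; f] ->
    P a b c d e f = 1 / (N%:R * (N%:R - 1) * (N%:R - 2)).
Proof.
move=> PK a b c d e f.
rewrite /= !inE !negb_or !andbT => /andP[/andP[ab ac] bc] /andP[/andP[de df] ef].
(* Here the equal rows are not adjacent, so orthogonality does not apply directly. The sum over the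
   middle row is [Q x x d f = 0], and its N-1 terms other than the middle row [x] coincide. *)
have aba x y : x != y -> P x y x d e f = 0.
  move=> xy; have := sum_moment3_col2 x x d e f.
  rewrite (@sum_const_but1 _ _ _ x (P x y x d e f)); last first.
    move=> z zx; apply: PK.
    by rewrite !ker3E (eq_sym x z) (negPf zx) (eq_sym y x) (negPf xy).
  rewrite moment3_row12 (negPf de) add0r card_ord moment2_row (negPf df).
  by move/eqP; rewrite mulf_eq0 (negPf N1) => /eqP.
have Qv x y : x != y -> Q x y d e = (N%:R - 2) * P a b c d e f.
  move=> xy; rewrite -(sum_moment3_col3 x y d e f).
  rewrite (@sum_const_but2 _ _ _ x y (P a b c d e f)) //; last first.
    move=> z zx zy; apply: PK.
    rewrite !ker3E (negPf xy) (eq_sym y z) (negPf zy) (eq_sym x z) (negPf zx).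
    by rewrite (negPf ab) (negPf bc) (negPf ac).
  by rewrite aba // moment3_row23 (negPf ef) !add0r card_ord.
have hv x : h (u x d) = (N%:R - 1) * ((N%:R - 2) * P a b c d e f).
  rewrite -(sum_moment2_col2 x d e).
  rewrite (@sum_const_but1 _ _ _ x ((N%:R - 2) * P a b c d e f)); last first.
    by move=> y yx; apply: Qv; rewrite eq_sym.
  by rewrite moment2_row (negPf de) add0r card_ord.
have := sum_moment1_col d; under eq_bigr do rewrite hv.
rewrite sumr_const card_ord => eq1.
have D0 : N%:R * (N%:R - 1) * (N%:R - 2) != 0 :> R[i] by rewrite !mulf_neq0.
by apply: (mulIf D0); rewrite /= divfK // -[RHS]eq1; ring.
Qed.

(** * All third moments from their value on distinct triples *)

Section UniformMoments.
Let k : R[i] := 1 / (N%:R * (N%:R - 1) * (N%:R - 2)).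
Hypothesis Pk : forall a b c d e f, uniq [:: a; b; c] -> uniq [:: d; e; f] ->
  P a b c d e f = k.

Let Pk' a b c d e f : a != b -> b != c -> a != c -> d != e -> e != f -> d != f ->
  P a b c d e f = k.
Proof.
move=> ab bc ac de ef df; apply: Pk; rewrite /= !inE !negb_or.
  by rewrite ab ac bc.
by rewrite de df ef.
Qed.

Lemma uniform_moment3_row13 a b c d e : a != b -> b != c -> a != c -> d != e ->
  P a b c d e d = Q a b d e - (N%:R - 2) * k.
Proof.
move=> ab bc ac de; rewrite -(sum_moment3_row3 a b c d e).
rewrite (@sum_const_but2 _ _ _ d e k) //; last first.
  by move=> f fd fe; apply: Pk'; rewrite // eq_sym.
by rewrite moment3_col23 (negPf bc) addr0 card_ord addrK.
Qed.

(* Summing the previous identity over b makes Q independent of its second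
   index, hence computable by one more summation. *)
Lemma uniform_moment2_moment1 a b d e : a != b -> d != e ->
  Q a b d e = h (u a d) - (N%:R - 2) ^+ 2 * k.
Proof.
move=> ab de.
(* [F x] is the defect in [uniform_moment3_row13] for the rows a, x, b; it vanishes unless x is a or
   b. Computing its sum by the sum rules and from these two terms isolates [Q a b d e]. *)
pose F x := P a x b d e d - (Q a x d e - (N%:R - 2) * k).
have sF : \sum_x F x = N%:R * (N%:R - 2) * k - h (u a d).
  rewrite /F sumrB sum_moment3_col2 moment2_col (negPf ab).
  rewrite sumrB sum_moment2_col2 sumr_const card_ord; ring.
have E : \sum_x F x = (N%:R - 2) * k + ((N%:R - 2) * k - Q a b d e).
  rewrite (@sum_const_but2 _ _ F a b 0) // => [|x xa xb]; last first.
    by rewrite /F uniform_moment3_row13 ?subrr // eq_sym.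
  rewrite mulr0 addr0 /F moment3_row12 (negPf de) moment2_row (negPf de).
  by rewrite moment3_row23 (eq_sym e) (negPf de) !sub0r !opprK opprB.
rewrite sF in E; apply/eqP; rewrite -subr_eq0; apply/eqP.
move/eqP: E; rewrite -subr_eq0 => /eqP E; rewrite -[RHS]E; ring.
Qed.

(** Summing the previous identity over [b] gives the linear equation (N-2) h = (N-1)(N-2)^2 k for
    the unknown [h (u a d)]. *)
Lemma uniform_moment1 a d : h (u a d) = (N%:R - 1) * (N%:R - 2) * k.
Proof.
have [e de] : exists e, d != e.
  case: (eqVneq d (Ordinal N_ge3)) => [->|]; last by exists (Ordinal N_ge3).
  by exists (Ordinal (ltnW N_ge3)).
have := sum_moment2_col2 a d e.
rewrite (@sum_const_but1 _ _ _ a (h (u a d) - (N%:R - 2) ^+ 2 * k)); last first.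
  by move=> b ba; apply: uniform_moment2_moment1; rewrite // eq_sym.
rewrite moment2_row (negPf de) add0r card_ord => E.
apply: (mulfI N2); apply/eqP; rewrite -subr_eq0; apply/eqP.
move/eqP: E; rewrite -subr_eq0 => /eqP E; rewrite -[RHS]E; ring.
Qed.

Lemma uniform_moment2 a b d e : Q a b d e =
  if a == b then (if d == e then (N%:R - 1) * (N%:R - 2) * k else 0)
  else if d == e then 0 else (N%:R - 2) * k.
Proof.
case: eqVneq => [<-|ab]; first by rewrite moment2_row uniform_moment1.
case: eqVneq => [<-|de]; first by rewrite moment2_col (negPf ab).
by rewrite uniform_moment2_moment1 // uniform_moment1; ring.
Qed.

Lemma uniform_moment3_row13_eq0 a b c d e :
  a != b -> b != c -> a != c -> d != e -> P a b c d e d = 0.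
Proof.
move=> ab bc ac de; rewrite uniform_moment3_row13 // uniform_moment2.
by rewrite (negPf ab) (negPf de) subrr.
Qed.

(** The equal rows are not adjacent, so the value is read off from the sum over the third row, which
    is [Q a b d e]: for [d = f] it is the only surviving term, and for distinct columns the other
    terms already add up to the sum. *)
Lemma uniform_moment3_aba a b d e f : a != b ->
  P a b a d e f = if (d == f) && (d != e) then (N%:R - 2) * k else 0.
Proof.
move=> ab.
case: (eqVneq d e) => [<-|de]; first by rewrite moment3_col12 (negPf ab) andbF.
case: (eqVneq e f) => [<-|ef].
  by rewrite moment3_col23 [b == a]eq_sym (negPf ab) (negPf de).
have := sum_moment3_col3 a b d e f; rewrite uniform_moment2 (negPf ab) (negPf de).
case: (eqVneq d f) => [df|df] /=.
  move=> <-; rewrite -df (@sum_const_but1 _ _ _ a 0) ?mulr0 ?addr0 // => c ca.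
  case: (eqVneq c b) => [->|cb]; first by rewrite moment3_row23 (eq_sym e) (negPf de).
  by apply: uniform_moment3_row13_eq0; rewrite // eq_sym.
rewrite (@sum_const_but2 _ _ _ a b k) // => [|c ca cb]; last first.
  by apply: Pk'; rewrite // eq_sym.
rewrite moment3_row23 (negPf ef) addr0 card_ord => /eqP.
by rewrite -subr_eq0 addrK => /eqP.
Qed.

(** With [k] expanded, the values are 1/N, [k] and 1/(N(N-1)): the inverse of the number of triples
    with the given pattern. The last branch serves the three patterns with two blocks. *)
Definition uniform_weight (K : bool * bool * bool) : R[i] :=
  if K == (true, true, true) then (N%:R - 1) * (N%:R - 2) * k
  else if K == (false, false, false) then k else (N%:R - 2) * k.

(** Thus the moment matrix is the averaging operator over the pattern classes. *)
Lemma uniform_moment3 a b c d e f : P a b c d e f =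
  if ker3 _ [tuple a; b; c] == ker3 _ [tuple d; e; f]
  then uniform_weight (ker3 _ [tuple a; b; c]) else 0.
Proof.
rewrite !ker3E.
case: (eqVneq a b) => [<-|ab].
  rewrite moment3_row12 uniform_moment2.
  by case: (a == c); case: (eqVneq d e) => [<-|_] //; case: (d == f); case: (e == f).
case: (eqVneq b c) => [<-|bc].
  rewrite (negPf ab) moment3_row23 uniform_moment2 (negPf ab).
  by case: (eqVneq e f) => [<-|_]; case: (d == e) => //; case: (d == f).
case: (eqVneq a c) => [<-|ac].
  rewrite uniform_moment3_aba //.
  case: (eqVneq d e) => [<-|de]; first by case: (d == f).
  by case: (eqVneq d f) => [<-|_]; [rewrite (eq_sym e) (negPf de) | case: (e == f)].
case: (eqVneq d e) => [<-|de]; first by rewrite moment3_col12 (negPf ab).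
case: (eqVneq e f) => [<-|ef]; first by rewrite moment3_col23 (negPf bc).
case: (eqVneq d f) => [<-|df]; first by rewrite uniform_moment3_row13_eq0.
exact: Pk'.
Qed.

Lemma uniform_class_function (xi : tensor_space R N 3) :
  (forall i, xi i = \sum_j (xi j : R[i]) * h (tensor_coef u i j)) ->
  forall i j, ker3 _ i = ker3 _ j -> xi i = xi j.
Proof.
move=> xiP i i' ii'; rewrite !xiP; apply: eq_bigr => j _; congr (_ * _).
rewrite (tuple3E _ i) (tuple3E _ i') (tuple3E _ j) !tensor_coef3.
by rewrite -!/(P _ _ _ _ _ _) !uniform_moment3 -!tuple3E ii'.
Qed.
End UniformMoments.

End ThirdMoments.

(** * Quantum permutation groups *)

Lemma magic_orthogonal (R : realType) (A : cstarAlgType R) (N : nat) (u : 'M[A]_N) :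
  is_magic u -> orthogonal_magic _ _ _ u.
Proof.
case=> uP ur uc; split=> // [i j l|i k j].
  case: eqVneq => [<-|jl]; first by case: (uP i j).
  exact: (projections_orthogonal _ _ _ (u i)).
case: eqVneq => [<-|ik]; first by case: (uP i j).
exact: (projections_orthogonal _ _ _ (u^~ j)).
Qed.

(** * Triply transitive permutation groups and patterns *)

Section TripleTransitivity.
Local Open Scope group_scope.
Variables (N : nat) (H : {group 'S_N}).

Lemma dtuple3_ker3 (t : 3.-tuple 'I_N) :
  (t \in 3.-dtuple([set: 'I_N])) = (ker3 _ t == (false, false, false)).
Proof.
rewrite (tuple3E _ t); move: [tnth t 0] [tnth t 1] [tnth t 2] => a b c.
rewrite inE memtE subset_all ker3E /= !inE negb_or !andbT.
by case: (a == b); case: (b == c); case: (a == c).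
Qed.

Lemma exists_notin (s : seq 'I_N) : (size s < N)%N -> exists x, x \notin s.
Proof.
move=> sN; apply/existsP; rewrite -negb_forall; apply: contraL sN => /forallP all_s.
rewrite -leqNgt -[X in (X <= _)%N]card_ord; apply: leq_trans (card_size s).
by apply: subset_leq_card; apply/subsetP => x _; apply: all_s.
Qed.

(** A triple with one or two distinct entries is completed to three distinct points, which [N >= 3]
    allows; so transitivity on distinct triples gives transitivity on every pattern class. *)
Lemma transitive3_ker3 : (3 <= N)%N -> [transitive^3 H, on [set: 'I_N] | 'P] ->
  forall i j : 3.-tuple 'I_N, ker3 _ i = ker3 _ j ->
    exists2 s, s \in H & j = n_act 'P i s.
Proof.
move=> N3 trH.
have actE a b c s : n_act 'P [tuple a; b; c] s = [tuple s a; s b; s c].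
  exact: val_inj.
have tr3 a b c a' b' c' : a != b -> b != c -> a != c ->
    a' != b' -> b' != c' -> a' != c' ->
    exists2 s : 'S_N, s \in H & [/\ s a = a', s b = b' & s c = c'].
  move=> /negPf ab /negPf bc /negPf ac /negPf ab' /negPf bc' /negPf ac'.
  have [||s sH] := atransP2 trH (_ : [tuple a; b; c] \in _)
                                (_ : [tuple a'; b'; c'] \in _).
  - by rewrite dtuple3_ker3 ker3E ab bc ac.
  - by rewrite dtuple3_ker3 ker3E ab' bc' ac'.
  by move/(congr1 val) => [-> -> ->]; exists s.
have tr2 a b a' b' : a != b -> a' != b' ->
    exists2 s : 'S_N, s \in H & s a = a' /\ s b = b'.
  move=> ab ab'; have [c] := exists_notin [:: a; b] N3.
  have [c'] := exists_notin [:: a'; b'] N3.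
  rewrite !inE !negb_or ![_ == a]eq_sym ![_ == b]eq_sym.
  rewrite ![_ == a']eq_sym ![_ == b']eq_sym.
  move=> /andP[ac' bc'] /andP[ac bc].
  by have [s sH [? ? _]] := tr3 _ _ _ _ _ _ ab bc ac ab' bc' ac'; exists s.
have tr1 a a' : exists2 s : 'S_N, s \in H & s a = a'.
  have [b] := exists_notin [:: a] (ltnW N3).
  have [b'] := exists_notin [:: a'] (ltnW N3).
  rewrite !inE ![_ == a]eq_sym ![_ == a']eq_sym => ab' ab.
  by have [s sH [? _]] := tr2 _ _ _ _ ab ab'; exists s.
move=> i j; have := ker3_mem _ i; rewrite (tuple3E _ i) (tuple3E _ j).
move: [tnth i 0] [tnth i 1] [tnth i 2] => a b c.
move: [tnth j 0] [tnth j 1] [tnth j 2] => a' b' c'.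
rewrite !ker3E !inE => K K'.
suff [s sH [ea eb ec]] : exists2 s : 'S_N, s \in H & [/\ s a = a', s b = b' & s c = c'].
  by exists s; rewrite // actE ea eb ec.
case: K' => Kab Kbc Kac.
case/or4P: K => [/eqP K|/eqP K|/eqP K|/orP[/eqP K|/eqP K]]; case: K => ab bc ac;
  rewrite ab in Kab; rewrite bc in Kbc; rewrite ac in Kac.
- rewrite -(eqP ab) -(eqP ac) -(eqP (esym Kab)) -(eqP (esym Kac)).
  by have [s sH sa] := tr1 a a'; exists s.
- rewrite -(eqP ab) -(eqP (esym Kab)).
  by have [s sH [sa sc]] := tr2 a c a' c' (negbT ac) (negbT (esym Kac)); exists s.
- rewrite -(eqP bc) -(eqP (esym Kbc)).
  by have [s sH [sa sb]] := tr2 a b a' b' (negbT ab) (negbT (esym Kab)); exists s.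
- rewrite -(eqP ac) -(eqP (esym Kac)).
  by have [s sH [sa sb]] := tr2 a b a' b' (negbT ab) (negbT (esym Kab)); exists s.
- by apply: tr3; apply: negbT.
Qed.

End TripleTransitivity.

(** * Coefficients of a closed subgroup and their comultiplication *)

Section QuantumPermutations.
Variables (R : realType) (N : nat) (SN : quantum_permutation_group R N).
Variable G : closed_subgroup SN.
Local Notation u := (magic_unitary G).

Lemma magic_unitary_orthogonal : orthogonal_magic _ _ _ u.
Proof.
apply: magic_orthogonal; have [[uP ur uc] _ _] := SN_universal SN.
split=> [i j|i|j].
- have [su uu] := uP i j.
  by split; rewrite !mxE; [rewrite -sub_proj_star su | rewrite -rmorphM uu].
- by under eq_bigr do rewrite mxE; rewrite -rmorph_sum ur rmorph1.
- by under eq_bigr do rewrite mxE; rewrite -rmorph_sum uc rmorph1.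
Qed.

Lemma Delta_magic_unitary i j :
  Delta G (u i j) = \sum_k tens (u i k) (u k j).
Proof.
rewrite mxE sub_Delta SN_Delta rmorph_sum; apply: eq_bigr => k _.
by rewrite /= sub_proj2E !mxE.
Qed.

Lemma Delta_tensor_coef3 (i j : 3.-tuple 'I_N) :
  Delta G (tensor_coef u i j) = \sum_k tens (tensor_coef u i k) (tensor_coef u k j).
Proof.
rewrite sum_tuple3 (tuple3E _ i) (tuple3E _ j).
move: [tnth i 0] [tnth i 1] [tnth i 2] [tnth j 0] [tnth j 1] [tnth j 2] => a b c d e f.
rewrite tensor_coef3 !rmorphM /= !Delta_magic_unitary mulr_suml mulr_suml.
apply: eq_bigr => x _; rewrite -mulrA mulr_suml mulr_sumr.
apply: eq_bigr => y _; rewrite mulr_sumr mulr_sumr.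
by apply: eq_bigr => z _; rewrite mulrA !tensor_coef3 -!(tensM (tensP G)).
Qed.

(** * Haar invariance and fixed vectors *)

Section HaarState.
Variable h : {scalar G}.
Hypothesis hP : is_haar h.

(** Apply [hr], that is id tensor [h], to the comultiplication of a coefficient: right invariance
    becomes the equation of a fixed vector. *)
Lemma haar_column_fixed (j : 3.-tuple 'I_N) :
  is_fixed u ([ffun i => h (tensor_coef u i j)] : tensor_space R N 3).
Proof.
case: hP => _ [hl [hr [_ _ hrE hDelta]]] i.
have [_ hrD] := hDelta (tensor_coef u i j); rewrite ffunE -hrD.
rewrite Delta_tensor_coef3 raddf_sum; apply: eq_bigr => k _.
by rewrite ffunE /= hrE.
Qed.

Lemma haar_fixed (xi : tensor_space R N 3) : is_fixed u xi ->
  forall i, xi i = \sum_j (xi j : R[i]) * h (tensor_coef u i j).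
Proof.
move=> xiF i; have := congr1 h (xiF i).
case: hP => -[_ h1] _; rewrite linearZ /= h1 [X in _ = X -> _]mulr1 => <-.
by rewrite raddf_sum; apply: eq_bigr => j _; rewrite /= linearZ.
Qed.

Lemma three_transitive_haar : (3 <= N)%N ->
  (three_transitive G <->
      forall i k p j l q : 'I_N, uniq [:: i; k; p] -> uniq [:: j; l; q] ->
        h (u i j * u k l * u p q)
        = 1 / (N%:R * (N%:R - 1) * (N%:R - 2))).
Proof.
move=> N3; have uO := magic_unitary_orthogonal.
rewrite /three_transitive (dim_Fix3 _ _ _ _ uO) //; split=> [FixK|hE xi].
  move=> i k p j l q.
  apply: (class_moments_uniform _ _ _ _ N3 uO); first by case: hP => -[].
  move=> a b c a' b' c' d e f ker_eq.
  have := FixK _ (haar_column_fixed [tuple d; e; f]) _ _ ker_eq.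
  by rewrite !ffunE !tensor_coef3.
move=> /haar_fixed xiE; apply: (uniform_class_function _ _ _ _ N3 uO h) => //.
Qed.

End HaarState.

(** * The case of a permutation group *)

Section ClassicalCase.
Local Open Scope group_scope.
Variable H : {group 'S_N}.
Hypothesis HG : is_classical G H.

(** Under [f], the coefficient at [i], [j] is the indicator of the [s] sending [j] to [i]. Evaluated
    at [s], the fixed vector equation says that [xi] takes the same value at [i] and at its image
    under the inverse of [s]. *)
Lemma classical_fixed (xi : tensor_space R N 3) :
  is_fixed u xi <->
  forall s, s \in H -> forall j : 3.-tuple 'I_N, xi (n_act 'P j s) = xi j.
Proof.
case: HG => f [fbij [flin f1 fM] _ fu].
have f0 : f 0%R = 0%R.
  by have := flin (-1)%R 0%R 0%R; rewrite scaler0 addr0 scaleN1r addNr.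
have fZ (c : R[i]) x : f (c *: x)%R = (c *: f x)%R.
  by have := flin c x 0%R; rewrite f0 !addr0.
have fD x y : f (x + y)%R = (f x + f y)%R.
  by have := flin 1%R x y; rewrite !scale1r.
have nK (j : 3.-tuple 'I_N) s : n_act 'P (n_act 'P j s) s^-1 = j := actK ('P * 3) s j.
have nVK (j : 3.-tuple 'I_N) s : n_act 'P (n_act 'P j s^-1) s = j := actKV ('P * 3) s j.
have fcoef (s : [subg H]) (i j : 3.-tuple 'I_N) :
    f (tensor_coef u i j) s = (n_act 'P j (sgval s) == i)%:R%R.
  rewrite (tuple3E _ i) (tuple3E _ j) tensor_coef3 !fM !ffunE !fu -!natrM !mulnb -andbA.
  by rewrite -[_ == [tuple _; _; _]]val_eqE /= !eqseq_cons andbT.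
have fE (s : [subg H]) (i : 3.-tuple 'I_N) :
    f (\sum_j (xi j : R[i]) *: tensor_coef u i j)%R s = xi (n_act 'P i (sgval s)^-1).
  rewrite (big_morph f fD f0) sum_ffunE (bigD1 (n_act 'P i (sgval s)^-1)) //=.
  rewrite big1 ?addr0 => [|j ji]; rewrite fZ ffunE fcoef.
    by rewrite nVK eqxx /GRing.scale /= mulr1.
  by case: eqP => [ij|_]; [rewrite -ij nK eqxx in ji | rewrite scaler0].
have gE (s : [subg H]) i : f ((xi i : R[i]) *: 1)%R s = xi i.
  by rewrite fZ f1 !ffunE /GRing.scale /= mulr1.
split=> [xiF s sH j|xiH i].
  have := congr1 (fun x => f x (subg H s)) (xiF (n_act 'P j s)).
  by rewrite fE gE subgK // nK => <-.
apply: (bij_inj fbij); apply/ffunP => s; rewrite fE gE.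
by apply: xiH; rewrite groupV subgP.
Qed.

Lemma three_transitive_classical : (3 <= N)%N ->
  (three_transitive G <-> [transitive^3 H, on [set: 'I_N] | 'P]).
Proof.
move=> N3; have uO := magic_unitary_orthogonal.
rewrite /three_transitive (dim_Fix3 _ _ _ _ uO) //; split=> [FixK|trH xi].
  pose x0 := [tuple Ordinal (ltnW (ltnW N3)); Ordinal (ltnW N3); Ordinal N3].
  have x0D : x0 \in 3.-dtuple([set: 'I_N]) by rewrite dtuple3_ker3.
  (* The indicator of an orbit is invariant, hence fixed, hence a class function by hypothesis;
     being 1 at [x0], it is 1 at every triple of distinct points. *)
  pose xi : tensor_space R N 3 := [ffun t => (t \in orbit ('P * 3) H x0)%:R%R].
  have xiF : is_fixed u xi.
    apply/classical_fixed => s sH j; rewrite !ffunE.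
    by rewrite -[n_act 'P j s]/(('P * 3)%act j s) orbit_actr.
  apply/imsetP; exists x0 => //; apply/setP => t; apply/idP/idP => [tD|].
    have := FixK xi xiF t x0; rewrite !ffunE orbit_refl /=.
    move: tD x0D; rewrite !dtuple3_ker3 => /eqP-> /eqP-> /(_ erefl).
    by case: (t \in _) => // /eqP; rewrite eq_sym oner_eq0.
  case/orbitP => s _ <-; apply: n_act_dtuple => //.
  by apply/astabsP => y; rewrite !inE.
move=> /classical_fixed xiH i j /(transitive3_ker3 _ _ N3 trH)[s sH ->].
by rewrite xiH.
Qed.

End ClassicalCase.
End QuantumPermutations.

Theorem theorem4p4 (R : realType) (N : nat) (N_ge3 : (3 <= N)%N)
    (SN : quantum_permutation_group R N) (G : closed_subgroup SN) :
  (forall h : {scalar G}, is_haar h ->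
     (three_transitive G <->
      forall i k p j l q : 'I_N, uniq [:: i; k; p] -> uniq [:: j; l; q] ->
        h (magic_unitary G i j * magic_unitary G k l * magic_unitary G p q)
        = 1 / (N%:R * (N%:R - 1) * (N%:R - 2))))
  /\
  (forall H : {group 'S_N}, is_classical G H ->
     (three_transitive G <-> [transitive^3 H, on [set: 'I_N] | 'P])).

Proof.
by split=> [h|H] GP; [apply: three_transitive_haar | apply: three_transitive_classical].
Qed.
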